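(* For a finite set $C=\{c_0,\ldots,c_{m-1}\}$ of $m\ge 2$ odd integers with $C\equiv\{1,3\}\pmod 4$, let $$\mathcal{N}(C)=\{A\in C^\infty:\ \Lambda(A)\neq\Lambda_I(A)\}.$$ Then the following statements hold. (i) There exists such a $C$ for which $\mathcal{N}(C)$ is empty. (ii) For every such $C$, the set $\mathcal{N}(C)$ is infinite if it is not empty. (iii) There exists such a $C$ for which $\mathcal{N}(C)$ contains countably many elements (i.e. is countably infinite). (iv) For any $\varepsilon>0$ there exists such a $C$ for which the Hausdorff dimension of $\mathcal{N}(C)$ is greater than $1-\varepsilon$, i.e. $\dim_H\mathcal{N}(C)>1-\varepsilon$.
   Context: $C\equiv\{1,3\}\pmod 4$ means that the set of residues modulo 4 of the elements of $C$ is $\{1,3\}$ (both residues occur). $C^\infty$ is the set of infinite sequences with entries in $C$. For $A=a_1a_2a_3\cdots\in C^\infty$ define $$\Lambda(A)=\left\{\sum_{k=1}^n4^{k-1}\omega_k:\ \omega_k\in\{0,a_k\},\ n\ge1\right\},$$ and let $\Lambda_I(A)$ be the set of integers $\lambda$ for which there exists a sequence $(\omega_k)_{k\ge1}$ with $\omega_k\in\{0,a_k\}$ for all $k$ such that $\lambda\equiv\sum_{k=1}^n4^{k-1}\omega_k\pmod{4^n}$ for all $n\ge1$. Hausdorff dimension is taken with respect to the metric on $C^\infty$ for which two distinct sequences have distance $m^{-\inf\{n:\ \text{the } n\text{th entries differ}\}}$, where $m=\#C$; the whole space $C^\infty$ then has Hausdorff dimension $1$. *)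

(* Defs.v *)
From HB Require Import structures.
From mathcomp Require Import all_boot all_order all_algebra finmap.
From mathcomp Require Import all_classical all_reals all_analysis.

Set Implicit Arguments.
Unset Strict Implicit.
Unset Printing Implicit Defensive.

Import Order.TTheory GRing.Theory Num.Theory.

Local Open Scope classical_set_scope.
Local Open Scope ring_scope.

Section hausdorff.
Context {R : realType} {T : metricType R}.
Implicit Types (U S : set T) (s delta : R).

Definition diam U : \bar R :=
  ereal_sup [set (mdist x y)%:E | x in U & y in U].

(* The empty set has weight 0 also for s = 0, where poweR would give 1; thus
   the 0-dimensional measure is the counting measure. *)
Definition diam_pow s U : \bar R :=
  if U == set0 then 0%E else poweR (diam U) s.

Definition hausdorff_content s delta S : \bar R :=
  ereal_inf [set (\sum_(0 <= i <oo) diam_pow s (U i))%E | U in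
    [set U : nat -> set T | S `<=` \bigcup_i U i /\
                            forall i, (diam (U i) <= delta%:E)%E]].

Definition hausdorff_measure s S : \bar R :=
  ereal_sup [set hausdorff_content s delta S | delta in [set d : R | 0 < d]].

Definition hausdorff_dim S : \bar R :=
  ereal_inf [set s%:E | s in [set s : R | 0 <= s /\ hausdorff_measure s S = 0%E]].

End hausdorff.

Definition admissible (C : {fset int}) : Prop :=
  [/\ (2 <= #|` C|)%N,
      forall c, c \in C -> ~~ (2%:Z %| c)%Z
    & [fset (c %% 4%:Z)%Z | c in C]%fset = [fset 1; 3]%fset].

(* The space C^oo; the entry A k stands for a_(k+1). R is a phantom parameter:
   it only records where the metric below takes its values. *)
Definition cseq (R : realType) (C : {fset int}) : Type := nat -> C.

Section cseq_metric.
Context (R : realType) (C : {fset int}).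
Implicit Types A B D : cseq R C.

(* Positions are counted from 1 in the metric, hence the successor. *)
Definition cseq_dist A B : R :=
  match pselect (exists k, A k != B k) with
  | left AB => (#|` C|)%:R ^- (ex_minn AB).+1
  | right _ => 0
  end.

Let dist_refl A : cseq_dist A A = 0.
Proof.
rewrite /cseq_dist; case: pselect => // AA; exfalso.
by case: AA => k; rewrite eqxx.
Qed.

Let card_gt0 A : (0 < #|` C|)%N.
Proof. by rewrite cardfs_gt0; apply/fset0Pn; exists (val (A 0%N)); exact: valP. Qed.

Let dist_positivity A B : cseq_dist A B = 0 -> A = B.
Proof.
rewrite /cseq_dist; case: pselect => [AB /eqP|AB _].
  by rewrite invr_eq0 expf_eq0 pnatr_eq0 eqn0Ngt (card_gt0 A) andbF.
by apply/funext => k; apply/eqP; apply: contrapT => /negP ABk; apply: AB; exists k.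
Qed.

Let dist_sym A B : cseq_dist A B = cseq_dist B A.
Proof.
rewrite /cseq_dist; case: pselect => [AB|AB]; case: pselect => [BA|BA] //.
- congr (_ ^- _.+1); apply/eqP; rewrite eqn_leq; apply/andP; split.
  + case: ex_minnP => n _ minn; apply: minn; case: ex_minnP => p.
    by rewrite eq_sym.
  + case: (ex_minnP BA) => n _ minn; apply: minn; case: ex_minnP => p.
    by rewrite eq_sym.
- by case: BA; case: AB => k ABk; exists k; rewrite eq_sym.
- by case: AB; case: BA => k ABk; exists k; rewrite eq_sym.
Qed.

Let dist_ge0 A B : 0 <= cseq_dist A B.
Proof.
by rewrite /cseq_dist; case: pselect => // AB; rewrite invr_ge0 exprn_ge0 ?ler0n.
Qed.

Let dist_ge A B k : A k != B k -> #|` C|%:R ^- k.+1 <= cseq_dist A B.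
Proof.
move=> ABk; rewrite /cseq_dist; case: pselect => [AB|]; last by case; exists k.
case: ex_minnP => n _ /(_ k ABk) nk.
have C1 : 1 <= #|` C|%:R :> R by rewrite ler1n (card_gt0 A).
rewrite lef_pV2 ?posrE ?exprn_gt0 ?(lt_le_trans ltr01 C1)//.
exact: ler_weXn2l.
Qed.

Let dist_triangle B A D : cseq_dist A D <= cseq_dist A B + cseq_dist B D.
Proof.
rewrite {1}/cseq_dist; case: pselect => [AD|_]; last by rewrite addr_ge0.
case: ex_minnP => k ADk _.
have [ABk|ABk] := eqVneq (A k) (B k).
  by rewrite -[leLHS]add0r lerD// dist_ge// -ABk.
by rewrite -[leLHS]addr0 lerD// dist_ge.
Qed.

HB.instance Definition _ := gen_eqMixin (cseq R C).
HB.instance Definition _ := gen_choiceMixin (cseq R C).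
HB.instance Definition _ :=
  isMetric.Build R (cseq R C) dist_refl dist_positivity dist_sym dist_triangle.

End cseq_metric.

Section spectra.
Context {R : realType} {C : {fset int}}.
Implicit Types (A : cseq R C) (w : nat -> int).

Definition digits A w : Prop := forall k, w k = 0 \/ w k = val (A k).

Definition partial_sum w n : int := \sum_(k < n) 4%:Z ^+ k * w k.

Definition Lambda A : set int :=
  [set l | exists w n, [/\ digits A w, (1 <= n)%N & l = partial_sum w n]].

Definition LambdaI A : set int :=
  [set l | exists2 w, digits A w &
     forall n, (1 <= n)%N -> (l = partial_sum w n %[mod 4%:Z ^+ n])%Z].

End spectra.

Definition Nset (R : realType) (C : {fset int}) : set (cseq R C) :=
  [set A | Lambda A <> LambdaI A].

Arguments Nset : clear implicits.

(* Main.v *)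
Require Import Defs.
From mathcomp Require Import all_boot all_order all_algebra finmap.
From mathcomp Require Import all_classical all_reals all_analysis.
From mathcomp Require Import zify lra ring.

(** Because every a_k is odd, the digit used at each position of a 4-adic
expansion of an integer l is forced by l mod 4.  Reading off digits therefore
produces a unique orbit x_0 = l, x_k = w_k + 4 x_(k+1), which either gets stuck
or goes on forever.  The set LambdaI collects the starting points of the
infinite orbits and Lambda those of the infinite orbits that reach 0, so that
A lies in N(C) if and only if A supports an infinite orbit avoiding 0 (NsetP).
All four statements are read off this criterion.

(i) For C = {1, -1} the orbit shrinks strictly in absolute value as long as it
avoids 0, so N(C) is empty.

(ii) If x is an orbit of A then 4 x_0, x_0, x_1, ... is an orbit of cA.  Hence
N(C) is stable under prepending letters, and from one of its elements A the
sequences c...cdA, with c, d two distinct letters, yield infinitely many.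

(iii) For C = {1, 3} an orbit avoiding 0 ends in the state -1, from which the
only way on is the loop -1 = 3 + 4 (-1).  Hence every element of N(C) is
eventually equal to 3 and N(C) is countable; the constant sequence 3 shows that
it is not empty, so it is infinite by (ii).

(iv) Take C = {1} together with the b letters 4^(j+1) - 1, j < b.  The set of
states -4^i, i < b, is kept by each of these letters: -1 goes to -4^j under
4^(j+1) - 1, and -4^(i+1) goes to -4^i with digit 0.  So N(C) contains all
sequences avoiding the letter 1.  There are b + 1 letters and b of them are
free, which gives dimension at least ln b / ln (b + 1), and this tends to 1.
For the lower bound on the dimension, base b expansion turns t in [0, 1[ into a
sequence f(t) of free letters with |t - u| <= b d(f t, f u)^s whenever
(b + 1)^s <= b.  A cover of N(C) thus pulls back to a cover of [0, 1[ by
sets inside intervals of length at most 2 b diam^s, and countable subadditivity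
of Lebesgue measure keeps the sum of the diam^s away from 0
(hausdorff_dim_hoelder). *)

Set Implicit Arguments.
Unset Strict Implicit.
Unset Printing Implicit Defensive.

Import Order.TTheory GRing.Theory Num.Theory.

Local Open Scope classical_set_scope.
Local Open Scope ring_scope.

(** * Orbits of the digit expansion *)

Definition odd_digits (C : {fset int}) : Prop :=
  forall c, c \in C -> ~~ (2%:Z %| c)%Z.

Lemma partial_sumS w n :
  partial_sum w n.+1 = w 0%N + 4%:Z * partial_sum (fun k => w k.+1) n.
Proof.
rewrite /partial_sum big_ord_recl expr0 mul1r mulr_sumr; congr (_ + _).
by apply: eq_bigr => i _; rewrite exprS mulrA.
Qed.

Section orbits.
Context {R : realType} {C : {fset int}}.
Implicit Types (A : cseq R C) (w x : nat -> int).

(** The states x_k = (x_0 - partial_sum w k) / 4^k left over after k digits of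
x_0 have been read; the recurrence avoids the division. *)
Definition orbit A w x : Prop :=
  digits A w /\ forall k, x k = w k + 4%:Z * x k.+1.

Lemma orbit_sum A w x n :
  orbit A w x -> x 0%N = partial_sum w n + 4%:Z ^+ n * x n.
Proof.
move=> [_ xE]; elim: n => [|n IHn].
  by rewrite /partial_sum big_ord0 add0r mul1r.
rewrite /partial_sum big_ord_recr/= -/(partial_sum w n) IHn {1}xE exprSr.
by rewrite mulrDr addrA mulrA.
Qed.

(** The congruences modulo 4^n say that the remainders left after n digits are
integers, and these remainders are the orbit. *)
Lemma LambdaI_orbitP A l :
  LambdaI A l <-> exists w x, orbit A w x /\ x 0%N = l.
Proof.
split=> [[w Aw lE]|[w [x [Ax <-]]]]; last first.
  exists w => [|n _]; first by case: Ax.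
  by rewrite (orbit_sum n Ax) mulrC addrC modzMDl.
have dvd n : (4%:Z ^+ n %| l - partial_sum w n)%Z.
  case: n => [|n]; first by rewrite expr0 dvd1z.
  by rewrite -eqz_mod_dvd; apply/eqP/lE.
pose x n := ((l - partial_sum w n) %/ 4%:Z ^+ n)%Z.
have xE n : l = partial_sum w n + x n * 4%:Z ^+ n.
  by rewrite /x divzK ?dvd// addrC subrK.
exists w, x; split; last by rewrite [RHS](xE 0%N) /partial_sum big_ord0 add0r mulr1.
split=> // k; have := xE k; rewrite (xE k.+1).
rewrite /partial_sum big_ord_recr/= -addrA => /addrI xk.
apply: (mulfI (_ : 4%:Z ^+ k != 0)); first by rewrite expf_neq0.
by rewrite mulrC -xk exprSr; ring.
Qed.

(** An odd digit a and the digit 0 differ modulo 4, so the residue of the state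
determines the digit, hence the next state. *)
Lemma digit_orbit_unique (a u v y z : int) : ~~ (2%:Z %| a)%Z ->
  u = 0 \/ u = a -> v = 0 \/ v = a ->
  u + 4%:Z * y = v + 4%:Z * z -> y = z.
Proof. by move=> a_odd [] -> [] ->; lia. Qed.

Hypothesis C_odd : odd_digits C.

(** A second expansion of the same integer has the same digits, so the orbit
follows the finite expansion v and has nothing left after n steps. *)
Lemma orbit_finite_sum n A w v x : orbit A w x -> digits A v ->
  x 0%N = partial_sum v n -> x n = 0.
Proof.
elim: n A w v x => [|n IHn] A w v x [Aw xE] Av.
  by rewrite /partial_sum big_ord0.
rewrite partial_sumS xE => eqx.
apply: (IHn (fun k => A k.+1) (fun k => w k.+1) (fun k => v k.+1)
          (fun k => x k.+1)).
- by split=> k; [exact: Aw | exact: xE].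
- by move=> k; exact: Av.
- exact: digit_orbit_unique (C_odd (valP (A 0%N))) (Aw _) (Av _) eqx.
Qed.

Lemma Lambda_orbitP A w x : orbit A w x ->
  Lambda A (x 0%N) <-> exists n, x n = 0.
Proof.
move=> Ax; split=> [[v [n [Av _ x0]]]|[n xn0]].
  by exists n; exact: orbit_finite_sum Ax Av x0.
have := orbit_sum n Ax; rewrite xn0 mulr0 addr0.
case: n xn0 => [x0 _|n _ ->]; last by exists w, n.+1; split=> //; case: Ax.
exists (fun=> 0), 1%N; split=> // [k|]; first by left.
by rewrite x0 /partial_sum big_ord1 mulr0.
Qed.

(** A finite expansion is continued by the digit 0. *)
Lemma Lambda_sub_LambdaI A : Lambda A `<=` LambdaI A.
Proof.
move=> _ [w [n [Aw _ ->]]]; apply/LambdaI_orbitP.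
elim: n A w Aw => [|n IHn] A w Aw.
  exists (fun=> 0), (fun=> 0); rewrite /partial_sum big_ord0; split=> //.
  by split=> k; [left | rewrite mulr0 addr0].
have [|v [y [[Av yE] y0]]] := IHn (fun k => A k.+1) (fun k => w k.+1).
  by move=> k; exact: Aw.
exists (fun k => if k is k'.+1 then v k' else w 0%N).
exists (fun k => if k is k'.+1 then y k' else w 0%N + 4%:Z * y 0%N).
split; last by rewrite partial_sumS y0.
by split=> -[|k]; [exact: Aw | exact: Av | | exact: yE].
Qed.

(** An element of LambdaI outside Lambda is precisely the start of an orbit that
avoids 0; this criterion is the only form in which N(C) is used below. *)
Lemma NsetP A :
  Nset R C A <-> exists w x, orbit A w x /\ forall n, x n != 0.
Proof.
split=> [|[w [x [Ax xn0]]]].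
  apply: contra_notP => noorbit; apply/seteqP; split=> [|l].
    exact: Lambda_sub_LambdaI.
  move=> /LambdaI_orbitP[w [x [Ax <-]]]; apply/(Lambda_orbitP Ax).
  apply: contra_notP noorbit => xn0; exists w, x; split=> // n.
  by apply/eqP => xn; apply: xn0; exists n.
move=> eqL; have /(Lambda_orbitP Ax)[n /eqP] : Lambda A (x 0%N).
  by rewrite eqL; apply/LambdaI_orbitP; exists w, x.
by apply/negP.
Qed.

(** * Prepending letters *)
Definition scons (c : C) A : cseq R C := fun k => if k is k'.+1 then A k' else c.

Lemma Nset_scons c A : Nset R C A -> Nset R C (scons c A).
Proof.
move=> /NsetP[w [x [[Aw xE] xn0]]]; apply/NsetP.
exists (fun k => if k is k'.+1 then w k' else 0).
exists (fun k => if k is k'.+1 then x k' else 4%:Z * x 0%N).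
split=> [|[|k]]; [|by rewrite mulf_neq0|exact: xn0].
by split=> -[|k]; [left | exact: Aw | rewrite add0r | exact: xE].
Qed.

(** For distinct letters c and d the sequences c...cdA are told apart by the
position of the first d. *)
Lemma infinite_Nset : (2 <= #|` C|)%N ->
  Nset R C !=set0 -> infinite_set (Nset R C).
Proof.
move=> C2 [A NA].
have [c [d cd]] : exists c d : C, c != d.
  have : (0 < #|` C|)%N by exact: leq_trans C2.
  rewrite cardfs_gt0 => /fset0Pn[c cC].
  have : (0 < #|` (C `\ c)%fset|)%N by rewrite (cardfsD1 c) cC in C2.
  rewrite cardfs_gt0 => /fset0Pn[d]; rewrite !inE => /andP[dc dC].
  by exists [` cC]%fset, [` dC]%fset; rewrite -val_eqE/= eq_sym.
pose B n := iter n (scons c) (scons d A).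
have Bn n : B n n = d by elim: n => [|n] /=.
have Blt k n : (k < n)%N -> B n k = c by elim: n k => [|n IHn] [|k] //= /IHn.
have B_inj : injective B.
  move=> n p BE; case: (ltngtP n p) => // np; exfalso; move: cd.
    by rewrite -(Blt _ _ np) -BE Bn eqxx.
  by rewrite -(Blt _ _ np) BE Bn eqxx.
have : infinite_set (range B).
  apply/infiniteP; rewrite (card_le_eqr (inj_card_eq _)) ?card_lexx//.
  by move=> n p _ _; exact: B_inj.
apply: sub_infinite_set => _ [n _ <-].
by elim: n => [|n] /=; exact: Nset_scons.
Qed.

End orbits.

(** * Alphabets with empty and with countable exceptional set *)
Lemma admissible_residues (C : {fset int}) : odd_digits C ->
  (exists2 c, c \in C & (c %% 4%:Z)%Z = 1) ->
  (exists2 c, c \in C & (c %% 4%:Z)%Z = 3) -> admissible C.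
Proof.
move=> C_odd [c cC c1] [d dC d3].
have CE : [fset (c %% 4%:Z)%Z | c in C]%fset = [fset 1; 3]%fset.
  apply/fsetP => r; rewrite !inE; apply/imfsetP/orP => /=.
    by move=> [b /C_odd b_odd ->]; lia.
  by move=> [/eqP -> | /eqP ->]; [exists c | exists d].
split=> //.
have := leq_imfset_card (imfset_key : unit) (fun c => (c %% 4%:Z)%Z) (mem C).
by rewrite CE cardfs2.
Qed.

(** Infinite descent on the absolute value of the state. *)
Lemma orbit_eventually (x : nat -> int) (P : nat -> Prop) :
  (forall n, P n \/ (`|x n.+1| < `|x n|)%N) -> exists n, P n.
Proof.
move=> descent; apply: contrapT => noP.
have bound n : (`|x n| + n <= `|x 0%N|)%N.
  elim: n => [|n IHn]; first by rewrite addn0.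
  case: (descent n) => [Pn|]; [by case: noP; exists n | lia].
by have := bound `|x 0%N|.+1; lia.
Qed.

Lemma admissible_pm1 : admissible [fset 1; -1]%fset.
Proof.
apply: admissible_residues => [c|| ]; first by rewrite !inE => /orP[]/eqP ->.
  by exists 1; rewrite ?inE.
by exists (-1); rewrite ?inE.
Qed.

(** Here |x_(k+1)| <= (|x_k| + 1) / 4 < |x_k| as long as x_k is not 0. *)
Lemma Nset_pm1 (R : realType) : Nset R [fset 1; -1]%fset = set0.
Proof.
have [_ C_odd _] := admissible_pm1.
apply/seteqP; split=> // A /(NsetP C_odd)[w [x [[Aw xE] xn0]]].
have [] // := @orbit_eventually x (fun=> False) => n; right.
have := valP (A n); have := xn0 n; have := xn0 n.+1; have := xE n; rewrite !inE.
by case: (Aw n) => -> ? ? ? /orP[]/eqP; lia.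
Qed.

Lemma admissible_13 : admissible [fset 1; 3]%fset.
Proof.
apply: admissible_residues => [c|| ]; first by rewrite !inE => /orP[]/eqP ->.
  by exists 1; rewrite ?inE.
by exists 3; rewrite ?inE.
Qed.

Lemma three_in_13 : (3 : int) \in [fset 1; 3]%fset.
Proof. by rewrite !inE. Qed.

(** The state -1 is absorbing: an odd digit must be used there, the digit 1 is
excluded because -1 is 3 modulo 4, and the digit 3 leads back to -1.  Any other
nonzero state moves strictly closer to 0. *)
Lemma Nset_13_eventually3 (R : realType) A : Nset R [fset 1; 3]%fset A ->
  exists n, forall k, (n <= k)%N -> val (A k) = 3.
Proof.
have [_ C_odd _] := admissible_13.
move=> /(NsetP C_odd)[w [x [[Aw xE] xn0]]].
have a13 k : val (A k) = 1 \/ val (A k) = 3.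
  by have := valP (A k); rewrite !inE => /orP[]/eqP ->; [left|right].
have step k : x k = - 1 -> val (A k) = 3 /\ x k.+1 = -1.
  by have := xE k; case: (a13 k); case: (Aw k) => ->; lia.
have [n xn] : exists n, x n = -1.
  apply: (@orbit_eventually x) => k.
  have := xE k; have := xn0 k; have := xn0 k.+1.
  by case: (Aw k) => ->; case: (a13 k); lia.
have xm1 k : x (n + k)%N = -1.
  by elim: k => [|k IHk]; [rewrite addn0 | rewrite addnS; case: (step _ IHk)].
by exists n => k nk; rewrite -(subnKC nk); case: (step _ (xm1 (k - n)%N)).
Qed.

(** A sequence that is eventually 3 is determined by a finite word. *)
Lemma Nset_13_countable (R : realType) : countable (Nset R [fset 1; 3]%fset).
Proof.
pose three : [fset 1; 3]%fset := [` three_in_13]%fset.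
pose pad (s : seq [fset 1; 3]%fset) : cseq R [fset 1; 3]%fset := nth three s.
apply: (@sub_countable _ _ _ (range pad)); last first.
  by apply: sub_countable (card_image_le _ _) _.
apply: subset_card_le => A /Nset_13_eventually3[n An]; exists (mkseq A n) => //.
apply/funext => k; rewrite /pad; case: (ltnP k n) => kn; first by rewrite nth_mkseq.
by rewrite nth_default ?size_mkseq//; apply: val_inj; rewrite /= An.
Qed.

Lemma Nset_13_nonempty (R : realType) : Nset R [fset 1; 3]%fset !=set0.
Proof.
have [_ C_odd _] := admissible_13.
exists (fun=> [` three_in_13]%fset); apply/(NsetP C_odd).
by exists (fun=> 3), (fun=> -1); split=> //; split=> // k; right.
Qed.

(** * Lower bounds for the Hausdorff dimension *)
Section hausdorff_lower_bound.
Context {R : realType} {T : metricType R}.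
Implicit Types (U E : set T).

Lemma mdist_le_diam U x y : U x -> U y -> ((mdist x y)%:E <= diam U)%E.
Proof. by move=> Ux Uy; apply: ereal_sup_ubound; exists x => //; exists y. Qed.

Lemma diam_pow_ge0 s U : (0 <= diam_pow s U)%E.
Proof. by rewrite /diam_pow; case: ifP => // _; exact: poweR_ge0. Qed.

(** The inverse of f expands distances in a controlled way, so the preimage of U
has diameter at most c (diam U)^s and fits in an interval of twice that length
around any of its points.  Passing from s to a smaller exponent r costs nothing
as diameters are at most 1. *)
Lemma hoelder_preim_itv (f : R -> T) (c r s : R) U : 0 < c -> 0 < s -> r <= s ->
  (forall t u : R, t \in `[0, 1[ -> u \in `[0, 1[ ->
     `|t - u| <= c * mdist (f t) (f u) `^ s) ->
  (diam U <= 1)%E ->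
  exists ab : R * R, [/\ (ab.1 <= ab.2),
    forall t : R, t \in `[0, 1[ -> U (f t) -> t \in `[ab.1, ab.2] &
    ((ab.2 - ab.1)%:E <= (2 * c)%:E * diam_pow r U)%E].
Proof.
move=> c0 s0 rs holder dU1.
have c20 : (0 <= (2 * c)%:E)%E by rewrite lee_fin mulr_ge0// ltW.
have [[u [u01 Uu]]|noU] := pselect (exists u, (u \in `[0, 1[) /\ U (f u)); last first.
  exists (0, 0); split=> //= [t t01 Ut|]; first by case: noU; exists t.
  by rewrite subr0 mule_ge0 ?diam_pow_ge0.
have U0 : (U == set0) = false by apply/negbTE/set0P; exists (f u).
have dU0 : (0 <= diam U)%E by have := mdist_le_diam Uu Uu; rewrite mdistxx.
have := @mdist_le_diam U; rewrite /diam_pow U0.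
case: (diam U) dU0 dU1 => //= d; rewrite !lee_fin => d0 d1 distd.
exists (u - c * d `^ r, u + c * d `^ r).
have cd0 : 0 <= c * d `^ r by rewrite mulr_ge0 ?powR_ge0// ltW.
split=> /=; [by lra | move=> t t01 Ut | by rewrite lee_fin; lra].
rewrite in_itv/= -ler_distl (le_trans (holder _ _ t01 u01))// ler_pM2l//.
have := distd _ _ Ut Uu; rewrite lee_fin.
have := mdist_ge0 (f t) (f u); rewrite le_eqVlt => /predU1P[<- _|t0 td].
  by rewrite powR0 ?powR_ge0// gt_eqF.
have d_gt0 := lt_le_trans t0 td.
apply: (le_trans (y := d `^ s)); first by rewrite ge0_ler_powR// ?nnegrE// ltW.
by apply: ger_powR => //; rewrite d_gt0.
Qed.

(** Mass distribution principle: if E receives the unit interval through a map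
whose inverse is s-Hoelder, every cover of E pulls back to a cover of [0, 1[,
whose total length is at least 1.  The interval plays the part of a Frostman
measure on E. *)
Lemma hausdorff_dim_hoelder E (f : R -> T) (c s : R) : 0 < c -> 0 < s ->
  (forall t : R, t \in `[0, 1[ -> E (f t)) ->
  (forall t u : R, t \in `[0, 1[ -> u \in `[0, 1[ ->
     `|t - u| <= c * mdist (f t) (f u) `^ s) ->
  (s%:E <= hausdorff_dim E)%E.
Proof.
move=> c0 s0 fE holder; apply: le_ereal_inf_tmp => _ [r [r0 Hr0] <-].
rewrite lee_fin leNgt; apply/negP => rs.
suff : (((2 * c)^-1)%:E <= hausdorff_measure r E)%E.
  by rewrite Hr0 lee_fin leNgt invr_gt0 mulr_gt0.
(* Covers by sets of diameter at most 1 already suffice. *)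
apply: (@le_trans _ _ (hausdorff_content r 1 E)); last first.
  by apply: ereal_sup_ubound; exists 1 => //=.
apply: le_ereal_inf_tmp => _ [U [EU dU1] <-].
have c20 : 0 < 2 * c by rewrite mulr_gt0.
have itv i := hoelder_preim_itv c0 s0 (ltW rs) holder (dU1 i).
have [ab abP] := choice itv.
pose I i : set R := `[(ab i).1, (ab i).2]%classic.
have : (lebesgue_measure (`[0%R, 1%R[%classic : set R) <=
        \sum_(0 <= i <oo) lebesgue_measure (I i))%E.
  apply: measure_sigma_subadditive => // [i|t t01]; first exact: measurable_itv.
  have [i _ Ut] := EU _ (fE t t01); exists i => //.
  by have [_ /(_ t t01 Ut)] := abP i.
rewrite lebesgue_measure_itv/= lte01 sube0 => /le_trans one_le.
rewrite -(lee_pmul2l _ (_ : (0 < (2 * c)%:E)%E))// -EFinM mulfV ?gt_eqF//.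
rewrite -nneseriesZl//; last by move=> i _; exact: diam_pow_ge0.
apply: one_le; apply: lee_nneseries => // i _.
have [ab_le _] := abP i; apply: le_trans.
rewrite lebesgue_measure_itv/= lte_fin; case: ifP => _ //.
by rewrite lee_fin subr_ge0.
Qed.

End hausdorff_lower_bound.

(** * Base b expansions *)
Section base_expansion.
Context {R : realType} (b : nat).
Hypothesis b_gt0 : (0 < b)%N.
Implicit Types t u : R.

Definition base_shift t : R := b%:R * t - (Num.truncn (b%:R * t))%:R.

Definition base_digit t k : nat := Num.truncn (b%:R * iter k base_shift t).

Lemma base_shift_itv t k : t \in `[0, 1[ -> iter k base_shift t \in `[0, 1[.
Proof.
move=> t01; elim: k => [//|k] /=; rewrite !in_itv/= => /andP[t0 _].
have /truncn_itv := mulr_ge0 (ler0n R b) t0.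
by rewrite -natr1 /base_shift => /andP[]; lra.
Qed.

Lemma base_digit_lt t k : t \in `[0, 1[ -> (base_digit t k < b)%N.
Proof.
move=> /(base_shift_itv k); rewrite in_itv/= => /andP[t0 t1].
by rewrite truncn_lt_nat ?mulr_ge0// gtr_pMr// ltr0n.
Qed.

(** On points with the same first digit the shift expands distances exactly by
the factor b. *)
Lemma base_digit_dist t u k : t \in `[0, 1[ -> u \in `[0, 1[ ->
  (forall i, (i < k)%N -> base_digit t i = base_digit u i) ->
  `|t - u| <= b%:R ^- k.
Proof.
move=> t01 u01 tu.
have b0 : b%:R != 0 :> R by rewrite pnatr_eq0 -lt0n.
have -> : t - u = b%:R ^- k * (iter k base_shift t - iter k base_shift u).
  elim: k tu => [|k IHk] tu; first by rewrite invr1 mul1r.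
  rewrite IHk => [/=|i ik]; last by apply: tu; exact: leqW.
  have := tu k (leqnn _); rewrite /base_digit /base_shift => ->.
  by rewrite opprB addrA subrK -mulrBr mulrA exprSr invfM -(mulrA _ b%:R^-1)
    mulVf// mulr1.
have := base_shift_itv k t01; have := base_shift_itv k u01; rewrite !in_itv/=.
move=> u_itv t_itv; rewrite normrM ger0_norm ?invr_ge0 ?exprn_ge0//.
rewrite ler_piMr ?invr_ge0 ?exprn_ge0// ler_norml.
by apply/andP; split; lra.
Qed.

End base_expansion.

(** If f t and f u first differ at position k (counted from 0), then
|t - u| <= b^-k while their distance is m^-(k+1), with m the size of C; this off
by one is the factor b in front, and m^s <= b compares the two bases. *)
Lemma cseq_digits_hoelder (R : realType) (C : {fset int}) (b : nat)
    (e : nat -> C) (s : R) : (1 < b)%N ->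
  {in [pred i | (i < b)%N] &, injective e} -> #|` C|%:R `^ s <= b%:R ->
  forall t u : R, t \in `[0, 1[ -> u \in `[0, 1[ ->
  `|t - u| <= b%:R * mdist (e \o base_digit b t : cseq R C)
                           (e \o base_digit b u) `^ s.
Proof.
move=> b1 e_inj Cb t u t01 u01; have b_gt0 := ltnW b1.
have dist k : (forall i, (i < k)%N -> e (base_digit b t i) = e (base_digit b u i)) ->
    `|t - u| <= b%:R ^- k.
  move=> tu; apply: base_digit_dist => // i /tu /e_inj; apply.
    exact: base_digit_lt.
  exact: base_digit_lt.
rewrite /mdist/= /cseq_dist; case: pselect => [tu|tu]; last first.
  rewrite (le_trans _ (_ : 0 <= _)) ?mulr_ge0 ?powR_ge0//.
  rewrite leNgt; apply/negP => d0.
  (* Equal expansions give |t - u| <= b^-k < 1/k for all k, so t = u. *)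
  set k := (Num.truncn `|t - u|^-1).+1.
  have tuk : `|t - u| <= b%:R ^- k.
    apply: dist => i _; apply: contrapT => /eqP tui.
    by apply: tu; exists i.
  have : `|t - u|^-1 < b%:R ^+ k.
    apply: lt_trans (truncnS_gt _) _.
    by rewrite -natrX ltr_nat ltn_expl.
  by rewrite ltNge -[_ ^+ k]invrK lef_pV2 ?posrE ?invr_gt0 ?exprn_gt0 ?ltr0n ?tuk.
case: ex_minnP => k _ kmin.
apply: (le_trans (dist k _)) => [i ik|].
  by apply: contrapT => /eqP /kmin; rewrite leqNgt ik.
have m0 : 0 < #|` C|%:R :> R.
  by rewrite ltr0n cardfs_gt0; apply/fset0Pn; exists (val (e 0%N)); exact: valP.
have b0 : 0 < b%:R :> R by rewrite ltr0n.
have -> : (#|` C|%:R ^- k.+1) `^ s = (#|` C|%:R `^ s) ^- k.+1 :> R.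
  by rewrite -!powR_invn ?ler0n ?powR_ge0// -!powRrM mulrC.
rewrite -ler_pdivrMl// -invfM -exprS.
rewrite lef_pV2 ?posrE ?exprn_gt0 ?powR_gt0//.
by rewrite lerXn2r// nnegrE ?powR_ge0// ltW.
Qed.

Lemma hausdorff_dim_subalphabet (R : realType) (C : {fset int}) (b : nat)
    (e : nat -> C) (s : R) (E : set (cseq R C)) : (1 < b)%N ->
  {in [pred i | (i < b)%N] &, injective e} ->
  0 < s -> #|` C|%:R `^ s <= b%:R ->
  (forall d : nat -> nat, (forall k, d k < b)%N -> E (e \o d)) ->
  (s%:E <= hausdorff_dim E)%E.
Proof.
move=> b1 e_inj s0 Cb eE.
apply: (hausdorff_dim_hoelder (T := cseq R C)
  (f := fun t => e \o base_digit b t) (c := b%:R)) => //.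
- by rewrite ltr0n ltnW.
- by move=> t t01; apply: eE => k; apply: base_digit_lt => //; exact: ltnW.
- exact: cseq_digits_hoelder.
Qed.

(** Dropping one letter out of b + 1 costs arbitrarily little dimension. *)
Lemma almost_full_exponent (R : realType) (delta : R) : 0 < delta ->
  exists2 b : nat, (1 < b)%N & b.+1%:R `^ (1 - delta) <= b%:R.
Proof.
move=> d0; pose b := (Num.truncn (2 `^ delta^-1 : R)).+2.
exists b => //.
have b2 : 2 <= b.+1%:R `^ delta.
  (* b is chosen larger than 2^(1/delta). *)
  have -> : 2 = (2 `^ delta^-1) `^ delta :> R.
    by rewrite -powRrM mulVf ?gt_eqF// powRr1.
  rewrite ge0_ler_powR ?nnegrE ?powR_ge0// 1?ltW//.
  by apply: lt_le_trans (truncnS_gt _) _; rewrite ler_nat /b ltnW.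
have p0 : 0 < b.+1%:R `^ delta :> R by rewrite powR_gt0.
(* After multiplication by (b+1)^delta >= 2 it is enough that b + 1 <= 2 b. *)
rewrite -(ler_pM2r p0) -powRD; last by rewrite pnatr_eq0 implybT.
rewrite subrK powRr1//; apply: (@le_trans _ _ (b%:R * 2)).
  by rewrite -natrM ler_nat; lia.
by rewrite ler_pM2l// ltr0n.
Qed.

(** * Alphabets with large exceptional set *)

(** The letter that leads from the state -1 to the state -4^j. *)
Definition letter (j : nat) : int := 4%:Z ^+ j.+1 - 1.

Definition letters (b : nat) : {fset int} :=
  [fset c in 1 :: [seq letter j | j <- iota 0 b]]%fset.

Lemma letter_mod j : (letter j %% 4%:Z)%Z = 3.
Proof. by rewrite /letter exprS; lia. Qed.

Lemma letter_inj : injective letter.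
Proof.
move=> i j /addIr; rewrite -!rmorphXn/= => -[].
by move/eqP; rewrite eqn_exp2l// => /eqP[].
Qed.

Lemma mem_letters b c :
  c \in letters b -> c = 1 \/ exists2 j, (j < b)%N & c = letter j.
Proof.
rewrite !inE => /orP[/eqP|/mapP[j]]; first by left.
by rewrite mem_iota => jb cE; right; exists j.
Qed.

Lemma letter_in b j : (j < b)%N -> letter j \in letters b.
Proof. by move=> jb; rewrite !inE; apply/orP; right; rewrite map_f// mem_iota. Qed.

Lemma one_in_letters b : 1 \in letters b. Proof. by rewrite !inE. Qed.

Lemma letters_odd b : odd_digits (letters b).
Proof.
move=> c /mem_letters[-> //|[j _ ->]].
by have := letter_mod j; lia.
Qed.

Lemma admissible_letters b : (0 < b)%N -> admissible (letters b).
Proof.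
move=> b0; apply: admissible_residues; first exact: letters_odd.
  by exists 1; first exact: one_in_letters.
by exists (letter 0%N); [exact: letter_in | exact: letter_mod].
Qed.

Lemma card_letters b : (#|` letters b| <= b.+1)%N.
Proof. by rewrite card_fseq (leq_trans (size_undup _))//= size_map size_iota. Qed.

(** The orbit starts at -1 and stays among the states -4^i: the state -1 reads a
letter 4^(j+1) - 1 and jumps to -4^j, the other states read the digit 0 and
divide by 4 until -1 is reached again. *)
Lemma Nset_letters (R : realType) b (A : cseq R (letters b)) (d : nat -> nat) :
  (forall k, val (A k) = letter (d k)) -> Nset R (letters b) A.
Proof.
move=> Ad; apply/(NsetP (letters_odd (b := b))).
(* The exponent of the state at time k. *)
pose j := fix j k := if k is k'.+1 then
  (if j k' is i.+1 then i else d k') else 0%N.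
exists (fun k => if j k == 0%N then val (A k) else 0).
exists (fun k => - 4%:Z ^+ j k).
split=> [|k]; last by rewrite oppr_eq0 expf_neq0.
split=> k /=; first by case: ifP; [right | left].
case: (j k) => [|i] /=; last by rewrite exprS; ring.
by rewrite Ad /letter exprS; ring.
Qed.

Lemma hausdorff_dim_Nset_letters (R : realType) (s : R) b : (1 < b)%N -> 0 < s ->
  b.+1%:R `^ s <= b%:R ->
  (s%:E <= hausdorff_dim (Nset R (letters b)))%E.
Proof.
move=> b1 s0 sb.
pose e j : letters b := insubd [` one_in_letters b]%fset (letter j).
have eE j : (j < b)%N -> val (e j) = letter j.
  by move=> jb; rewrite val_insubd letter_in.
apply: (hausdorff_dim_subalphabet b1 (e := e)) => //.
- by move=> i j ib jb /(congr1 val); rewrite !eE// => /letter_inj.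
- by apply: le_trans sb; rewrite ge0_ler_powR ?nnegrE ?ler_nat ?card_letters// ltW.
- by move=> d db; apply: (@Nset_letters _ _ _ d) => k; rewrite /= eE.
Qed.

Theorem theorem3p11 (R : realType) :
  [/\ exists2 C : {fset int}, admissible C & Nset R C = set0,
      forall C : {fset int}, admissible C ->
        Nset R C !=set0 -> infinite_set (Nset R C),
      exists2 C : {fset int}, admissible C & (Nset R C #= [set: nat])%card
    & forall eps : R, 0 < eps ->
        exists2 C : {fset int}, admissible C &
          ((1 - eps)%:E < hausdorff_dim (Nset R C))%E].
Proof.
have prepend C : admissible C -> Nset R C !=set0 -> infinite_set (Nset R C).
  by move=> [C2 C_odd _]; exact: infinite_Nset.
split=> [|//||eps eps0].
- exists [fset 1; -1]%fset; [exact: admissible_pm1 | exact: Nset_pm1].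
- exists [fset 1; 3]%fset; first exact: admissible_13.
  apply: eq_card_nat; first exact: Nset_13_countable.
  by apply: prepend; [exact: admissible_13 | exact: Nset_13_nonempty].
(* Capping eps at 1 keeps the exponent 1 - delta positive. *)
pose delta : R := Num.min eps 1 / 2.
have m0 : 0 < Num.min eps 1 by rewrite lt_min eps0 ltr01.
have [me m1] : Num.min eps 1 <= eps /\ Num.min eps 1 <= 1 by rewrite !ge_min !lexx orbT.
have d0 : 0 < delta by rewrite divr_gt0.
have [b b1 db] := almost_full_exponent d0.
exists (letters b); first exact: admissible_letters (ltnW b1).
apply: lt_le_trans (hausdorff_dim_Nset_letters b1 _ db); last by rewrite /delta; lra.
by rewrite lte_fin /delta; lra.
Qed.
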